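(* Let $n\in\mathbb{N}$ and let $A:\mathbb{R}_+\to\mathbb{R}^{n\times n}$ be a (measurable) map that is integrable over $\mathbb{R}_+$, i.e. $\int_0^\infty\|A(t)\|\,dt<\infty$. Then for every $\zeta(\cdot)\in C_{\lim}(\mathbb{R}_+,\mathbb{R}^n)$ there exists a uniquely determined $x(\cdot)\in C_{\lim}(\mathbb{R}_+,\mathbb{R}^n)$ such that $$\zeta(t)=x(t)-\int_0^t A(s)x(s)\,ds\qquad\text{for all } t\in\mathbb{R}_+.$$
   Context: $\mathbb{R}_+=[0,\infty)$. $C_{\lim}(\mathbb{R}_+,\mathbb{R}^n)$ denotes the space of continuous functions $x:\mathbb{R}_+\to\mathbb{R}^n$ for which the limit $\lim_{t\to\infty}x(t)$ exists in $\mathbb{R}^n$; it is equipped with the supremum norm $\|\cdot\|_\infty$. $\|A(t)\|$ is the operator norm induced by the norm on $\mathbb{R}^n$. *)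

(* Defs.v *)
From mathcomp Require Import all_boot all_order all_algebra.
From mathcomp Require Import all_classical all_reals all_analysis.

Set Implicit Arguments.
Unset Strict Implicit.
Unset Printing Implicit Defensive.

Import Order.TTheory GRing.Theory Num.Theory.
Import numFieldNormedType.Exports.

Local Open Scope classical_set_scope.
Local Open Scope ring_scope.

(* The real line with the sigma-algebra of Lebesgue-measurable sets (the
   library's measurableTypeR R carries only the Borel sets); it is the domain
   of completed_lebesgue_measure. *)
Definition lebesgueTypeR (R : realType) :=
  caratheodory_type (@wlength R idfun)^*%mu.

Definition lebesgue_mu (R : realType) :
  {measure set (lebesgueTypeR R) -> \bar R} := @completed_lebesgue_measure R.

Definition half_line (R : realType) : set R := `[0, +oo[%classic.
Arguments half_line R : clear implicits.

Record is_norm (R : realType) (n : nat) (N : 'cV[R]_n -> R) : Prop := IsNorm {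
  is_norm_triangle : forall u v, N (u + v) <= N u + N v;
  is_norm_scale : forall (a : R) u, N (a *: u) = `|a| * N u;
  is_norm_eq0 : forall u, N u = 0 -> u = 0
}.

Definition op_norm (R : realType) (n : nat) (N : 'cV[R]_n -> R)
    (B : 'M[R]_n) : R :=
  sup [set N (B *m v) | v in [set v : 'cV[R]_n | N v <= 1]].

(* Functions on [0, +oo) are represented by functions on R of which only the
   restriction to [0, +oo) matters.  The topology on 'cV[R]_n is the library's,
   which is the one defined by any norm. *)
Definition C_lim (R : realType) (n : nat) : set (R -> 'cV[R]_n) :=
  [set x | {within half_line R, continuous x} /\
           exists l : 'cV[R]_n, x t @[t --> +oo] --> l].

Definition lebesgue_measurable_mx (R : realType) (n : nat)
    (A : R -> 'M[R]_n) : Prop :=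
  forall i j, @measurable_fun _ _ (lebesgueTypeR R) (measurableTypeR R)
                (half_line R) (fun t => A t i j).

Definition integral_cV (R : realType) (n : nat) (D : set R)
    (f : R -> 'cV[R]_n) : 'cV[R]_n :=
  \col_i \int[@lebesgue_mu R]_(s in D) f s i 0.

(* Main.v *)
Require Import Defs.
From mathcomp Require Import all_boot all_order all_algebra.
From mathcomp Require Import all_classical all_reals all_analysis.
From mathcomp Require Import measurable_realfun ring lra.

Set Implicit Arguments.
Unset Strict Implicit.
Unset Printing Implicit Defensive.

Import Order.TTheory GRing.Theory Num.Theory.
Import numFieldNormedType.Exports.

Local Open Scope classical_set_scope.
Local Open Scope ring_scope.

(** Componentwise the equation is a linear Volterra equation
    x(t) = zeta(t) + (K x)(t), with (K x)(t) the integral of A x over [0, t],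
    and the theorem holds because K is a contraction of the bounded functions
    on the half-line, with ratio 1/2, for a suitable weighted supremum norm
    (volterra_contraction).

    Let a(s) be the sum of the absolute values of the entries of A(s). All norms
    on R^n being equivalent, a is at most a constant times the operator norm of
    A(s), so it is integrable (op_norm_integrable_entry); comparing the two
    integrals through their definition as suprema over simple functions spares
    a proof that the operator norm of A(s) is measurable in s.

    The one analytic idea is to split a as a <= k 1_[0,k] + c with the integral
    of c as small as desired, by dominated convergence (integrable_split). It
    is used twice.

    - The weight w(t) = exp (4 k min(t,k)) satisfies
      (integral of a w over [0, t]) <= w(t) / 2: the bounded part contributes at
      most w(t) / 4 because w is an exponential, and the part c at most w(t) / 4
      because w is nondecreasing and c has integral at most 1/4
      (exists_weight). As 1 <= w <= exp (4 k^2), the weighted norm is equivalent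
      to the supremum norm. An exponential of the primitive of a would also do,
      but would need calculus for absolutely continuous functions.

    - A primitive of an integrable function varies by at most e + k |s - t|
      between s and t, and by at most e beyond k (primitive_dist). It is
      therefore continuous and Cauchy at infinity, so K maps bounded measurable
      functions into C_lim (volterra_C_lim).

    Uniqueness is the iterated contraction estimate for the difference of two
    solutions. For existence, the Picard iterates starting from zeta converge
    uniformly to a bounded measurable x with zeta + K x = x on the half-line;
    the function zeta + K x is then the solution, and it lies in C_lim without
    any uniform limit theorem, because K x does. *)

(** * Integration of real-valued functions *)

Section real_integrals.
Context d (T : measurableType d) (R : realType) (mu : {measure set T -> \bar R}).
Implicit Types (D E : set T) (f g a : T -> R).

Lemma integrable_measurable D f :
  mu.-integrable D (EFin \o f) -> measurable_fun D f.
Proof. by move=> /(measurable_int mu)/measurable_EFinP. Qed.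

Lemma le_integrable_real D f g : measurable D -> measurable_fun D f ->
  (forall s, D s -> `|f s| <= g s) -> mu.-integrable D (EFin \o g) ->
  mu.-integrable D (EFin \o f).
Proof.
move=> mD mf fg ig; apply: (le_integrable mD _ _ ig).
  exact/measurable_EFinP.
by move=> s Ds /=; rewrite lee_fin (le_trans (fg s Ds))// ler_norm.
Qed.

Lemma Rintegral_ge0_subset D E f : measurable D -> measurable E ->
  D `<=` E -> mu.-integrable E (EFin \o f) -> (forall s, E s -> 0 <= f s) ->
  \int[mu]_(s in D) f s <= \int[mu]_(s in E) f s.
Proof.
move=> mD mE DE fi f0.
have fiD : mu.-integrable D (EFin \o f) by exact: integrableS fi.
rewrite /Rintegral fine_le//; [exact: integrable_fin_num..|].
apply: ge0_subset_integral => //.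
by case/integrableP: fi.
Qed.

(** An integrable function is bounded up to an integrable error of small
    integral. The error is the excess of a over the truncation k 1_(E k); it is
    dominated by a and vanishes at each point for large k. *)
Lemma integrable_split D a (E : nat -> set T) : measurable D ->
  (forall k, measurable (E k)) ->
  (forall s, D s -> \forall k \near \oo, E k s) ->
  mu.-integrable D (EFin \o a) -> (forall s, D s -> 0 <= a s) ->
  forall e, 0 < e -> exists (k : nat) (c : T -> R),
    [/\ mu.-integrable D (EFin \o c),
        forall s, D s -> 0 <= c s,
        \int[mu]_(s in D) c s <= e
      & forall s, D s -> a s <= k%:R * \1_(E k) s + c s].
Proof.
move=> mD mE Ecov ia a0 e e0.
pose c (k : nat) s := Num.max (a s - k%:R * \1_(E k) s) 0.
have mc k : measurable_fun D (c k).
  apply: measurable_maxr => //; apply: measurable_funB => //.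
    exact: integrable_measurable.
  by apply: measurable_funM => //; exact: measurable_indic.
have c0 k s : 0 <= c k s by rewrite /c le_max lexx orbT.
have ca k s : D s -> c k s <= a s.
  by move=> Hs; rewrite /c ge_max a0// andbT gerBl mulr_ge0.
have ic k : mu.-integrable D (EFin \o c k).
  by apply: le_integrable_real ia => // s Hs; rewrite ger0_norm// ca.
have cc s : D s -> (c n s)%:E @[n --> \oo] --> 0%E.
  move=> Hs; apply: cvg_near_cst; near=> n.
  rewrite /c indicE mem_set/=; last by near: n; exact: Ecov.
  rewrite mulr1 max_r// subr_le0; near: n; exact: nbhs_infty_ger.
have : (\int[mu]_(s in D) (c n s)%:E)%E @[n --> \oo] --> (0 : \bar R)%E.
  rewrite -[X in _ --> X](integral0 mu D).
  apply: (@dominated_cvg _ _ _ mu _ mD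
    (fun n => EFin \o c n) _ (EFin \o a)) => //.
  - by move=> n; exact/measurable_EFinP.
  - by move=> n s Hs /=; rewrite lee_fin ger0_norm// ca.
move=> /fine_cvgP[_ /cvgr_le /(_ _ e0)] [k _ /(_ k (leqnn k)) /= cke].
exists k, (c k); split => //.
by move=> s Hs; rewrite -lerBlDl /c le_max lexx.
Unshelve. all: by end_near. Qed.
End real_integrals.

(** The integral of a nonnegative function is a supremum over the simple
    functions below it, hence it is monotone without measurability. *)
Lemma ge0_le_integral_nonmeasurable d (T : measurableType d) (R : realType)
  (mu : {measure set T -> \bar R}) (D : set T) (f g : T -> \bar R) :
  (forall x, D x -> (0 <= f x)%E) -> (forall x, D x -> (f x <= g x)%E) ->
  (\int[mu]_(x in D) f x <= \int[mu]_(x in D) g x)%E.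
Proof.
move=> f0 fg; have g0 x : D x -> (0 <= g x)%E.
  by move=> Dx; exact: le_trans (f0 x Dx) (fg x Dx).
rewrite !ge0_integralE//; apply: ereal_sup_le => _ [h hf <-]; exists h => // x.
apply: le_trans (hf x) _; rewrite /= !patchE.
by case: ifPn => // /set_mem; exact: fg.
Qed.

(** * The completed Lebesgue measure on the half-line *)

Local Notation L_measurable := (@measurable _ (lebesgueTypeR _)).
Local Notation L_measurable_fun :=
  (@measurable_fun _ _ (lebesgueTypeR _) (measurableTypeR _)).
Local Notation L_integrable D f := ((lebesgue_mu _).-integrable D (EFin \o f)).

Lemma borel_lebesgue_measurable (R : realType) (D : set R) :
  @measurable _ (measurableTypeR R) D -> @measurable _ (lebesgueTypeR R) D.
Proof. exact: sub_caratheodory. Qed.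

Lemma lebesgue_muE (R : realType) (D : set R) :
  lebesgue_mu R D = @lebesgue_measure R D.
Proof. by []. Qed.

Lemma borel_lebesgue_measurable_fun (R : realType) (D : set R) (f : R -> R) :
  @measurable _ (measurableTypeR R) D ->
  @measurable_fun _ _ (measurableTypeR R) (measurableTypeR R) D f ->
  @measurable_fun _ _ (lebesgueTypeR R) (measurableTypeR R) D f.
Proof.
by move=> mD mf _ Y mY; apply: borel_lebesgue_measurable; exact: mf.
Qed.

(** Brings the fundamental theorem of calculus, available for the measure on
    Borel sets, to the completed measure: the former is the image of the latter
    under the identity map. *)
Lemma ge0_integral_lebesgue_mu (R : realType) (D : set R) (f : R -> R) :
  @measurable _ (measurableTypeR R) D ->
  @measurable_fun _ _ (measurableTypeR R) (measurableTypeR R) D f ->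
  (forall y, D y -> 0 <= f y) ->
  (\int[lebesgue_mu R]_(x in D) (f x)%:E =
   \int[@lebesgue_measure R]_(x in D) (f x)%:E)%E.
Proof.
move=> mD mf f0.
have mid : @measurable_fun _ _ (lebesgueTypeR R) (measurableTypeR R) setT idfun.
  by move=> _ Y mY; rewrite setTI; exact: borel_lebesgue_measurable.
have f0' : {in D, forall y, (0 <= (EFin \o f) y)%E}.
  by move=> y /set_mem Dy; rewrite lee_fin f0.
apply/esym.
exact: (ge0_integral_pushforward mid (lebesgue_mu R) mD
  ((measurable_EFinP _ _).2 mf) f0').
Qed.

Section half_line_integrals.
Variable R : realType.
Local Notation mu := (lebesgue_mu R).
Implicit Types (D E : set R) (f g a : R -> R).

Lemma itv_lebesgue_measurable (i : interval R) : L_measurable [set` i].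
Proof. exact: borel_lebesgue_measurable. Qed.

Lemma half_line_measurable : L_measurable (half_line R).
Proof. exact: itv_lebesgue_measurable. Qed.

Lemma half_lineE (t : R) : half_line R t = (0 <= t) :> Prop.
Proof. by rewrite /half_line/= in_itv/= andbT. Qed.

Lemma subset_itv_half_line (b0 : bool) (s t : R) :
  half_line R s -> [set` Interval (BSide b0 s) (BRight t)] `<=` half_line R.
Proof.
rewrite /half_line/= in_itv/= andbT => s0 r /=; rewrite !in_itv/= andbT.
by move=> /andP[+ _]; case: b0 => /= [|/ltW]; exact: le_trans.
Qed.

Lemma lebesgue_mu_itv (b0 b1 : bool) (s t : R) : s <= t ->
  mu [set` Interval (BSide b0 s) (BSide b1 t)] = (t - s)%:E.
Proof.
move=> st; rewrite lebesgue_muE lebesgue_measure_itv/= lte_fin.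
by case: ltgtP st => // -> _; rewrite subrr.
Qed.

Lemma L_integrable_cst (s t r : R) : L_integrable `[s, t] (cst r).
Proof.
have mst : L_measurable `[s, t] by exact: itv_lebesgue_measurable.
apply: (measurable_bounded_integrable mst).
- have [st|ts] := leP s t; first by rewrite lebesgue_mu_itv// ltry.
  by rewrite set_itv_ge ?bnd_simp -?ltNge// measure0.
- exact: measurable_cst.
- exists `|r|; split; [exact: num_real|move=> x rx y _ /=; exact: ltW].
Qed.

Lemma L_integrable_sub_half_line f (b0 : bool) (s t : R) : 0 <= s ->
  L_integrable (half_line R) f ->
  L_integrable [set` Interval (BSide b0 s) (BRight t)] f.
Proof.
move=> s0; apply: integrableS.
- exact: half_line_measurable.
- exact: itv_lebesgue_measurable.
- by apply: subset_itv_half_line; rewrite half_lineE.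
Qed.

Lemma integrable_split_half_line a : L_integrable (half_line R) a ->
  (forall s, half_line R s -> 0 <= a s) -> forall e, 0 < e ->
  exists (k : nat) (c : R -> R),
    [/\ L_integrable (half_line R) c,
        forall s, half_line R s -> 0 <= c s,
        \int[mu]_(s in half_line R) c s <= e
      & forall s, half_line R s ->
          a s <= k%:R * \1_(`]-oo, k%:R] : set R) s + c s].
Proof.
move=> ia a0 e e0.
apply: (@integrable_split _ (lebesgueTypeR R) R mu (half_line R) a
  (fun k => [set` `]-oo, k%:R]])) => //.
- exact: half_line_measurable.
- by move=> k; exact: itv_lebesgue_measurable.
- by move=> s Hs; near=> k; rewrite /= in_itv/=; near: k; exact: nbhs_infty_ger.
Unshelve. all: by end_near. Qed.

End half_line_integrals.

(** * The exponential weight *)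

Section weight.
Variable R : realType.
Local Notation mu := (lebesgue_mu R).
Implicit Types (D E : set R) (f g a : R -> R).

Lemma continuous_scaled_expR (k a : R) :
  continuous (fun s : R => k * expR (a * s)).
Proof.
move=> s; apply: cvgM; first exact: cvg_cst.
apply: (@continuous_comp _ _ _ (fun s => a * s) expR).
  exact: mulrl_continuous.
exact: continuous_expR.
Qed.

Lemma Rintegral_expR (k t : R) : 0 <= k -> 0 <= t ->
  \int[mu]_(s in `[0, t]) (k * expR (4 * k * s)) = (expR (4 * k * t) - 1) / 4.
Proof.
move=> k0 t0; rewrite /Rintegral ge0_integral_lebesgue_mu//; last 2 first.
- apply: measurable_funTS; apply: continuous_measurable_fun.
  exact: continuous_scaled_expR.
- by move=> y _; rewrite mulr_ge0// expR_ge0.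
move: t0; rewrite le_eqVlt => /predU1P[<-|t0].
  by rewrite set_itv1 integral_set1/= mulr0 expR0 subrr mul0r.
have dF (x : R) : is_derive x 1 (fun s : R => expR (4 * k * s) / 4)
    (k * expR (4 * k * x)).
  rewrite (_ : (fun s => _) =
      (4^-1 : R) \*: (expR \o ((4 * k) \*: (idfun : R -> R)))); last first.
    by apply/funext => s /=; rewrite mulrC.
  apply: is_derive_eq.
  by rewrite /GRing.scale/=; field.
have cF (x : R) : {for x, continuous (fun s : R => expR (4 * k * s) / 4)}.
  apply: differentiable_continuous; apply/derivable1_diffP.
  exact: (@ex_derive _ _ _ _ _ _ _ (dF x)).
rewrite (@continuous_FTC2 _ _ (fun s => expR (4 * k * s) / 4))//.
- by rewrite /= mulr0 expR0; field.
- by apply: continuous_subspaceT; exact: continuous_scaled_expR.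
- split.
  + by move=> x _; exact: (@ex_derive _ _ _ _ _ _ _ (dF x)).
  + exact: cvg_at_right_filter (cF 0).
  + exact: cvg_at_left_filter (cF t).
- by move=> x _; rewrite derive1E; exact: derive_val.
Qed.

(** The weight is the exponential that turns the bounded part of a, carried by
    [0, k], into a contraction; it is frozen after k, where only the small part
    of a remains. Both parts contribute w t / 4. *)
Lemma exists_weight a : L_integrable (half_line R) a ->
  (forall s, half_line R s -> 0 <= a s) ->
  exists (w : R -> R) (W : R),
    [/\ L_measurable_fun (half_line R) w,
        forall s, half_line R s -> 1 <= w s <= W
      & forall t, half_line R t ->
          \int[mu]_(s in `[0, t]) (a s * w s) <= w t / 2].
Proof.
move=> ia a0.
have e4 : 0 < 4^-1 :> R by rewrite invr_gt0.
have [k [c [ic c0 ce ac]]] := integrable_split_half_line ia a0 e4.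
pose w (s : R) := expR (4 * k%:R * Num.min s k%:R).
have k4 : 0 <= 4 * k%:R :> R by rewrite mulr_ge0.
have w_le s t : s <= t -> w s <= w t.
  by move=> st; rewrite ler_expR ler_wpM2l// le_min !ge_min st lexx orbT.
have w_ub s : w s <= expR (4 * k%:R * k%:R).
  by rewrite ler_expR ler_wpM2l// ge_min lexx orbT.
have mw : L_measurable_fun (half_line R) w.
  apply: borel_lebesgue_measurable_fun; first exact: measurable_itv.
  apply: (measurableT_comp (@measurable_expR R)).
  by apply: measurable_funM => //; exact: measurable_minr.
have w1 s : half_line R s -> 1 <= w s.
  rewrite half_lineE => s0.
  by rewrite -expR0 ler_expR mulr_ge0// le_min s0/=.
exists w, (expR (4 * k%:R * k%:R)); split => //.
  by move=> s Hs; rewrite w1 ?w_ub.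
move=> t Ht; have t0 : 0 <= t by move: Ht; rewrite half_lineE.
have m0t : L_measurable `[0, t] by exact: itv_lebesgue_measurable.
have mH := @half_line_measurable R.
have sub : `[0, t] `<=` half_line R.
  by apply: subset_itv_half_line; rewrite half_lineE.
have restr f : L_integrable (half_line R) f -> L_integrable `[0, t] f.
  by move=> h; exact: (integrableS mH m0t sub h).
(* a w <= g + w(t) c on [0, t], and g, the part of k w before k, is a
   derivative *)
pose g : R -> R := (fun s => k%:R * expR (4 * k%:R * s)) \_ (`]-oo, k%:R]).
have Ig : \int[mu]_(s in `[0, t]) g s <= w t / 4.
  rewrite /g -Rintegral_mkcondr.
  have -> : `[0, t] `&` `]-oo, k%:R] = `[0, Num.min t k%:R]%classic.
    by apply/seteqP; split => s /=; rewrite !in_itv/= le_min;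
      [move=> [/andP[-> ->] ->]|move=> /and3P[-> -> ->]].
  rewrite Rintegral_expR// ?le_min ?t0//= ler_wpM2r//.
  by rewrite /w gerBl.
have iaw : L_integrable `[0, t] (fun s => a s * w s).
  have mw0t : L_measurable_fun `[0, t] w by exact: measurable_funS mH sub mw.
  have ma : L_measurable_fun `[0, t] a := integrable_measurable (restr _ ia).
  apply: (le_integrable_real m0t (measurable_funM ma mw0t) _
    (integrableZr m0t (expR (4 * k%:R * k%:R)) (restr _ ia))).
  move=> s /sub Hs; have w0 : 0 <= w s by exact: expR_ge0.
  by rewrite ger0_norm ?mulr_ge0 ?a0// ler_wpM2l// a0.
have ig : L_integrable `[0, t] g.
  have mg :
      @measurable_fun _ _ (measurableTypeR R) (measurableTypeR R) `[0, t] g.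
    apply: measurable_funTS; apply/(measurable_restrictT _ _).1 => //.
    apply: measurable_funTS; apply: continuous_measurable_fun.
    exact: continuous_scaled_expR.
  apply: (le_integrable_real m0t (borel_lebesgue_measurable_fun _ mg) _
    (L_integrable_cst 0 t (k%:R * expR (4 * k%:R * k%:R)))).
    exact: measurable_itv.
  move=> s _; rewrite /g patchE mem_setE in_itv/=; case: ifPn => sk; last first.
    by rewrite normr0 mulr_ge0// expR_ge0.
  by rewrite ger0_norm ?mulr_ge0 ?expR_ge0// ler_wpM2l// ler_expR ler_wpM2l.
have icw : L_integrable `[0, t] (fun s => c s * w t).
  exact: (integrableZr m0t (w t) (restr _ ic)).
have : \int[mu]_(s in `[0, t]) (a s * w s) <=
       \int[mu]_(s in `[0, t]) (g s + c s * w t).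
  apply: (le_Rintegral m0t iaw _ _).
    exact: (integrableD m0t ig icw).
  move=> s /[dup] /sub Hs; rewrite /= in_itv/= => /andP[s0 st].
  have ws := w1 _ Hs; have wst := w_le _ _ st.
  have cw : c s * w s <= c s * w t by rewrite ler_wpM2l// c0.
  apply: le_trans (lerD (lexx _) cw); rewrite -lerBlDr -mulrBl.
  rewrite /g patchE mem_setE in_itv/=.
  have := ac s Hs; rewrite indicE mem_setE in_itv/=.
  case: ifPn => sk; rewrite ?sk ?(negPf sk)/=.
    rewrite mulr1 => acs; rewrite -[X in expR (_ * X)](min_l sk) ler_wpM2r//.
      exact: ltW (lt_le_trans ltr01 ws).
    by rewrite lerBlDr.
  rewrite mulr0 add0r => acs; rewrite mulr_le0_ge0 ?subr_le0//.
  exact: ltW (lt_le_trans ltr01 ws).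
move/le_trans; apply; rewrite (RintegralD m0t ig icw).
rewrite (RintegralZr _ m0t (restr _ ic)).
have : (\int[mu]_(s in `[0, t]) c s) * w t <= 4^-1 * w t.
  rewrite ler_wpM2r//; first exact: expR_ge0.
  apply: le_trans ce; exact: (Rintegral_ge0_subset m0t mH sub ic c0).
by move: Ig; lra.
Qed.

End weight.

(** * Primitives of integrable functions *)

Section primitive.
Variable R : realType.
Local Notation mu := (lebesgue_mu R).
Implicit Types (D E : set R) (f g a : R -> R).

(** Uniform smallness of the integral of |f| over short intervals and over
    intervals that lie far away, in one statement; both come from a single
    splitting of |f|. *)
Lemma Rintegral_uniformly_small f : L_integrable (half_line R) f ->
  forall e, 0 < e -> exists k : nat, forall s t, 0 <= s -> s <= t ->
    \int[mu]_(r in `]s, t]) `|f r| <= e + k%:R * (t - s) /\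
    (k%:R <= s -> \int[mu]_(r in `]s, t]) `|f r| <= e).
Proof.
move=> fi e e0; pose a r := `|f r|.
have ia : L_integrable (half_line R) a by exact: integrable_norm.
have a0 s : half_line R s -> 0 <= a s by move=> _; exact: normr_ge0.
have [k [c [ic c0 ce ac]]] := integrable_split_half_line ia a0 e0.
exists k => s t s0 st.
have mst : L_measurable `]s, t] by exact: itv_lebesgue_measurable.
have mH := @half_line_measurable R.
have sub : `]s, t] `<=` half_line R.
  by apply: subset_itv_half_line; rewrite half_lineE.
have restr g : L_integrable (half_line R) g -> L_integrable `]s, t] g.
  by move=> h; exact: (integrableS mH mst sub h).
have ce' : \int[mu]_(r in `]s, t]) c r <= e.
  by apply: le_trans ce; exact: (Rintegral_ge0_subset mst mH sub ic c0).
split=> [|ks].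
  have ick : L_integrable `]s, t] (cst (k%:R : R)).
    by apply: (integrableS _ mst _ (L_integrable_cst s t k%:R));
      [exact: itv_lebesgue_measurable | exact: subset_itv_oc_cc].
  apply: (@le_trans _ _ (\int[mu]_(r in `]s, t]) (c r + cst k%:R r))).
    apply: (le_Rintegral mst (restr _ ia) (integrableD mst (restr _ ic) ick)).
    move=> r /sub Hr; rewrite addrC; apply: le_trans (ac r Hr) _.
    by rewrite lerD2r ler_piMr// indicE lern1 leq_b1.
  rewrite (RintegralD mst (restr _ ic) ick) lerD// (Rintegral_cst _ mst).
  by rewrite lebesgue_mu_itv.
apply: le_trans ce'; apply: (le_Rintegral mst (restr _ ia) (restr _ ic)).
move=> r /[dup] /sub Hr; rewrite /= in_itv/= => /andP[sr _].
apply: le_trans (ac r Hr) _; rewrite indicE memNset ?mulr0 ?add0r//=.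
by rewrite in_itv/= leNgt (le_lt_trans ks).
Qed.

Lemma Rintegral_increment f : L_integrable (half_line R) f ->
  forall s t, 0 <= s -> s <= t ->
  `|\int[mu]_(r in `[0, t]) f r - \int[mu]_(r in `[0, s]) f r| <=
    \int[mu]_(r in `]s, t]) `|f r|.
Proof.
move=> fi s t s0 st.
have mst : L_measurable `]s, t] by exact: itv_lebesgue_measurable.
have m0s : L_measurable `[0, s] by exact: itv_lebesgue_measurable.
have U : `[0, t]%classic = `[0, s] `|` `]s, t] :> set R.
  apply/seteqP; split=> r /=; rewrite !in_itv/=.
    by move=> /andP[-> ->]; rewrite andbT; case: leP => _; [left|right].
  move=> [/andP[-> rs]|/andP[sr ->]]; first by rewrite (le_trans rs).
  by rewrite (le_trans s0 (ltW sr)).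
have i0t := L_integrable_sub_half_line true t (lexx 0) fi.
have ist := L_integrable_sub_half_line false t s0 fi.
rewrite U (Rintegral_setU m0s mst) -?U//; last first.
  apply/disj_setPS => r /= []; rewrite !in_itv/= => /andP[_ rs] /andP[sr _].
  by move: (le_lt_trans rs sr); rewrite ltxx.
by rewrite addrAC subrr add0r; exact: le_normr_Rintegral.
Qed.

(** Gives at once the continuity of the primitive and its Cauchy property at
    infinity. *)
Lemma primitive_dist f : L_integrable (half_line R) f ->
  forall e, 0 < e -> exists k : nat, forall s t, 0 <= s -> 0 <= t ->
  let F t := \int[mu]_(r in `[0, t]) f r in
    `|F s - F t| <= e + k%:R * `|s - t| /\
    (k%:R <= s -> k%:R <= t -> `|F s - F t| <= e).
Proof.
move=> fi e /(Rintegral_uniformly_small fi)[k kP]; exists k => s t + + F.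
wlog st : s t / s <= t => [h s0 t0|s0 t0].
  have [st|/ltW ts] := leP s t; first exact: h.
  by rewrite distrC (distrC s); have [] := h t s ts t0 s0; split=> // *; auto.
have inc := Rintegral_increment fi s0 st; have [k1 k2] := kP s t s0 st.
rewrite distrC (distrC s) [X in _ * X]ger0_norm ?subr_ge0//; split.
  exact: le_trans k1.
by move=> ks _; exact: le_trans (k2 ks).
Qed.

Lemma primitive_continuous f : L_integrable (half_line R) f ->
  {within half_line R, continuous (fun t => \int[mu]_(r in `[0, t]) f r)}.
Proof.
move=> fi; apply/subspace_continuousP => x; rewrite half_lineE => x0.
apply/cvgrPdist_le => /= e e0.
have e20 : 0 < e / 2 by rewrite divr_gt0.
have [k kP] := primitive_dist fi e20.
have d0 : 0 < e / 2 / k.+1%:R by rewrite divr_gt0.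
have hx : \forall t \near x, `|x - t| <= e / 2 / k.+1%:R.
  by have /cvgrPdist_le /(_ _ d0) := @cvg_id _ (nbhs x).
rewrite near_withinE; near=> t; rewrite half_lineE => t0.
have [+ _] := kP x t x0 t0; move/le_trans; apply.
have : k%:R * `|x - t| <= e / 2; last by lra.
apply: (@le_trans _ _ (k.+1%:R * `|x - t|)).
  by rewrite ler_wpM2r// ler_nat.
rewrite mulrC -ler_pdivlMr; last exact: ltr0Sn.
by near: t; exact: hx.
Unshelve. end_near. Qed.

Lemma primitive_cvg f : L_integrable (half_line R) f ->
  exists l : R, \int[mu]_(r in `[0, t]) f r @[t --> +oo] --> l.
Proof.
move=> fi; pose F (t : R) := \int[mu]_(r in `[0, t]) f r.
suff /cvg_ex : cvg (F t @[t --> +oo]) by [].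
apply/cauchy_cvgP/cauchy_exP => e e0.
have e20 : 0 < e / 2 by rewrite divr_gt0.
have [k kP] := primitive_dist fi e20.
exists (F k%:R); rewrite /nbhs/=; near=> t.
have kt : k%:R <= t by near: t; exact: nbhs_pinfty_ge.
have t0 : 0 <= t by exact: le_trans (ler0n _ _) kt.
rewrite /ball/=; have [_ /(_ (lexx _) kt) h] := kP k%:R t (ler0n _ _) t0.
by rewrite (le_lt_trans h)// ltr_pdivrMr// ltr_pMr// ltr1n.
Unshelve. all: by end_near. Qed.

End primitive.

(** * Norms on column vectors *)

Section norms.
Variables (R : realType) (n : nat) (N : 'cV[R]_n -> R).
Hypothesis hN : is_norm N.

Lemma is_norm0 : N 0 = 0.
Proof. by rewrite -(scale0r 0) (is_norm_scale hN) normr0 mul0r. Qed.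

Lemma is_normN u : N (- u) = N u.
Proof. by rewrite -scaleN1r (is_norm_scale hN) normrN1 mul1r. Qed.

Lemma is_norm_ge0 u : 0 <= N u.
Proof.
have := is_norm_triangle hN u (- u); rewrite subrr is_norm0 is_normN; lra.
Qed.

Lemma is_norm_dist u v : `|N u - N v| <= N (u - v).
Proof.
have h a b : N a - N b <= N (a - b).
  by have := is_norm_triangle hN (a - b) b; rewrite subrK; lra.
rewrite ler_norml h andbT; have := h v u.
by rewrite -(is_normN (v - u)) opprB; lra.
Qed.

Lemma is_norm_sum (u : 'cV[R]_n) :
  N u <= \sum_i `|u i 0| * N (delta_mx i 0).
Proof.
have -> : N u = N (\sum_i u i 0 *: delta_mx i 0).
  congr N; rewrite {1}[u]matrix_sum_delta; apply: eq_bigr => i _.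
  by rewrite big_ord1.
elim/big_ind2: _ => [|x1 x2 y1 y2 h1 h2|i _].
- by rewrite is_norm0.
- by apply: le_trans (is_norm_triangle hN _ _) _; exact: lerD.
- by rewrite (is_norm_scale hN).
Qed.

Lemma mx_coord_le m p (M : 'M[R]_(m, p)) i j : `|M i j| <= `|M|.
Proof.
rewrite [leRHS]/Num.norm/= mx_normrE.
by apply/bigmax_geP; right; exists (i, j).
Qed.

(** Stated on row vectors because the compactness of closed bounded sets is a
    statement about row vectors. *)
Lemma is_norm_continuous : continuous (fun v : 'rV[R]_n => N v^T).
Proof.
pose C := \sum_(i < n) N (delta_mx i 0).
have C0 : 0 <= C by rewrite sumr_ge0// => i _; exact: is_norm_ge0.
have lip (u v : 'rV[R]_n) : `|N u^T - N v^T| <= C * `|u - v|.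
  apply: le_trans (is_norm_dist _ _) _; apply: le_trans (is_norm_sum _) _.
  rewrite mulr_suml ler_sum// => i _; rewrite mulrC ler_wpM2l ?is_norm_ge0//.
  by rewrite -raddfB mxE mx_coord_le.
move=> u; apply/(@cvgrPdist_le _ _ _ _ (nbhs_filter u)) => /= e e0.
have d0 : 0 < e / (C + 1) by rewrite divr_gt0// ltr_wpDl.
have hu : \forall v \near u, `|u - v| <= e / (C + 1).
  by apply/nbhs_normP; exists (e / (C + 1)) => //= v /ltW.
apply: filterS hu => v; rewrite ler_pdivlMr ?ltr_wpDl// => uv.
apply: le_trans (lip _ _) _; apply: le_trans uv; rewrite mulrC ler_wpM2l//.
by rewrite lerDl.
Qed.

(** The nontrivial half of the equivalence of norms: N attains a positive
    minimum on the unit sphere of the supremum norm, which is empty when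
    n = 0. *)
Lemma coord_le_is_norm : exists2 c : R, 0 <= c &
  forall (v : 'cV[R]_n) i, `|v i 0| <= c * N v.
Proof.
pose S := [set u : 'rV[R]_n | `|u| = 1].
have inS (v : 'cV[R]_n) : v != 0 -> S (`|v^T|^-1 *: v^T).
  move=> v0; rewrite /S/= normrZ normfV normr_id mulVf// normr_eq0.
  by apply: contra v0 => /eqP v0; rewrite -[v]trmxK v0 trmx0.
(* the sphere is empty when n = 0; then 0 is the only vector *)
have [S0|S0] := pselect (S !=set0); last first.
  exists 0 => // v i; rewrite mul0r; have [->|v0] := eqVneq v 0.
    by rewrite mxE normr0.
  by exfalso; apply: S0; exists (`|v^T|^-1 *: v^T); exact: inS.
have cS : compact S.
  apply: bounded_closed_compact.
    by exists 1; split => // x x1 u /= ->; exact: ltW.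
  rewrite (_ : S = Num.norm @^-1` [set x : R | x = 1])//.
  apply: preimage_closed; last exact: closed_eq.
  by move=> u _; exact: norm_continuous.
have cN : {within S, continuous (fun v : 'rV[R]_n => N v^T)}.
  by apply: continuous_subspaceT; exact: is_norm_continuous.
have [u Su umin] := compact_EVT_min S0 cS cN.
have m0 : 0 < N u^T.
  rewrite lt_neqAle is_norm_ge0 andbT eq_sym; apply/eqP => /(is_norm_eq0 hN) u0.
  move: Su; rewrite inE /S/= -[u]trmxK u0 trmx0 normr0 => /eqP.
  by rewrite eq_sym oner_eq0.
exists (N u^T)^-1; first by rewrite invr_ge0 ltW.
move=> v i; have [->|v0] := eqVneq v 0.
  by rewrite mxE normr0 is_norm0 mulr0.
rewrite mulrC ler_pdivlMr//.
have := umin (`|v^T|^-1 *: v^T); rewrite inE => /(_ (inS _ v0)).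
rewrite linearZ/= trmxK (is_norm_scale hN) normfV normr_id.
have vT0 : 0 < `|v^T|.
  rewrite normr_gt0; apply: contra v0 => /eqP v0.
  by rewrite -[v]trmxK v0 trmx0.
rewrite mulrC ler_pdivlMr// mulrC; apply: le_trans.
rewrite ler_wpM2r//; first exact: ltW.
by have := mx_coord_le v^T 0 i; rewrite mxE.
Qed.

(** The supremum that defines op_norm is zero by convention when the set is
    unbounded, so the point of the proof is the boundedness of that set. *)
Lemma op_norm_ub (B : 'M[R]_n) v : N v <= 1 -> N (B *m v) <= op_norm N B.
Proof.
move=> v1; apply: ub_le_sup; last by exists v.
have [c c0 cN] := coord_le_is_norm.
exists (\sum_i (\sum_j `|B i j| * c) * N (delta_mx i 0)) => _ [u u1 <-].
apply: le_trans (is_norm_sum _) _; rewrite ler_sum// => i _.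
rewrite ler_wpM2r ?is_norm_ge0// mxE; apply: le_trans (ler_norm_sum _ _ _) _.
rewrite ler_sum// => j _; rewrite normrM ler_wpM2l//.
by apply: le_trans (cN _ _) _; rewrite ler_piMr.
Qed.

Lemma op_norm_ge0 (B : 'M[R]_n) : 0 <= op_norm N B.
Proof.
by apply: le_trans (op_norm_ub B (v := 0) _); rewrite ?is_norm_ge0 ?is_norm0.
Qed.

(** The entry B i j is a coordinate of B e_j, and e_j / N e_j is a unit
    vector. *)
Lemma entry_le_op_norm :
  exists2 C : R, 0 < C & forall (B : 'M[R]_n) i j, `|B i j| <= C * op_norm N B.
Proof.
have [c c0 cN] := coord_le_is_norm.
pose K := \sum_(j < n) N (delta_mx j 0).
have K0 : 0 <= K by rewrite sumr_ge0// => i _; exact: is_norm_ge0.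
exists (c * K + 1); first by rewrite ltr_wpDl// mulr_ge0.
move=> B i j; pose e : 'cV[R]_n := delta_mx j 0.
have Be : (B *m e) i 0 = B i j by rewrite /e -colE mxE.
have e0 : 0 < N e.
  rewrite lt_neqAle is_norm_ge0 andbT eq_sym; apply/eqP => /(is_norm_eq0 hN).
  by move=> /matrixP /(_ j 0) /eqP; rewrite !mxE !eqxx/= oner_eq0.
have Ne : N (B *m e) <= N e * op_norm N B.
  have e1 : N ((N e)^-1 *: e) <= 1.
    rewrite (is_norm_scale hN) normfV ger0_norm ?is_norm_ge0//.
    by rewrite mulVf// gt_eqF.
  have := op_norm_ub B e1; rewrite -scalemxAr (is_norm_scale hN) normfV.
  by rewrite (ger0_norm (is_norm_ge0 e)) mulrC ler_pdivrMr// mulrC.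
rewrite -Be; apply: le_trans (cN _ _) _.
apply: (@le_trans _ _ (c * K * op_norm N B)); last first.
  by rewrite ler_wpM2r ?op_norm_ge0// lerDl.
rewrite -mulrA ler_wpM2l//; apply: le_trans Ne _.
rewrite ler_wpM2r ?op_norm_ge0// /K (bigD1 j)//= lerDl sumr_ge0// => ? _.
exact: is_norm_ge0.
Qed.

End norms.

Lemma op_norm_integrable_entry (R : realType) (n : nat) (N : 'cV[R]_n -> R)
    (hN : is_norm N) (A : R -> 'M[R]_n) (mA : lebesgue_measurable_mx A)
    (iA : (\int[@lebesgue_mu R]_(t in half_line R) (op_norm N (A t))%:E < +oo)%E)
    i j :
  L_integrable (half_line R) (fun s => A s i j).
Proof.
have [C C0 AC] := entry_le_op_norm hN.
have mH := @half_line_measurable R.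
suff iC : L_integrable (half_line R) (fun s => C^-1 * `|A s i j|).
  apply: (le_integrable_real mH (mA i j) _ (integrableZl mH C iC)) => s _.
  by rewrite /= mulVKf// gt_eqF.
apply/integrableP; split.
  apply/measurable_EFinP; apply: (measurable_funM (measurable_cst _)).
  exact: (measurableT_comp (@normr_measurable R setT) (mA i j)).
apply: le_lt_trans iA; apply: ge0_le_integral_nonmeasurable => s _.
  exact: abse_ge0.
rewrite /= lee_fin ger0_norm ?mulr_ge0 ?invr_ge0 ?(ltW C0)//.
by rewrite mulrC ler_pdivrMr// mulrC.
Qed.

(** * The space of continuous functions with a limit at infinity *)

Lemma cvg_coordP (R : realType) (m n : nat) (T : Type) (F : set_system T)
    (FF : Filter F) (f : T -> 'M[R]_(m, n)) (M : 'M[R]_(m, n)) :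
  f t @[t --> F] --> M <-> forall i j, f t i j @[t --> F] --> M i j.
Proof.
split=> [fM i j|fM].
  exact: cvg_comp fM (@coord_continuous R m n i j M).
move=> P [Q MQ QP]; rewrite /nbhs/=.
have : \forall t \near F, forall i j, Q i j (f t i j).
  by apply: filter_forall => i; apply: filter_forall => j; exact: fM (MQ i j).
by apply: filterS => t Qt; apply: QP.
Qed.

Section C_lim_theory.
Variables (R : realType) (n : nat).
Implicit Types x y : R -> 'cV[R]_n.

Lemma C_limP x : C_lim x <-> forall i,
  {within half_line R, continuous (fun t => x t i 0)} /\
  exists l : R, x t i 0 @[t --> +oo] --> l.
Proof.
split=> [[cx [l xl]] i|xP].
  split; last by exists (l i 0); move/cvg_coordP: xl; exact.
  move/subspace_continuousP: cx => cx; apply/subspace_continuousP => t Ht.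
  by move: (cx t Ht) => /cvg_coordP; exact.
have [l xl] := choice (fun i => (xP i).2).
split; last first.
  by exists (\col_i l i); apply/cvg_coordP => i j; rewrite ord1 mxE.
apply/subspace_continuousP => t Ht; apply/cvg_coordP => i j; rewrite ord1.
by have [/subspace_continuousP cx _] := xP i; exact: cx.
Qed.

Lemma C_limD x y : C_lim x -> C_lim y -> C_lim (fun t => x t + y t).
Proof.
move=> [cx [l xl]] [cy [l' yl]]; split; last by exists (l + l'); exact: cvgD.
by move=> t; apply: cvgD; [exact: cx|exact: cy].
Qed.

Lemma continuous_cvg_bounded (g : R -> R) (l : R) :
  {within half_line R, continuous g} -> g t @[t --> +oo] --> l ->
  exists2 M, 0 <= M & forall s, half_line R s -> `|g s| <= M.
Proof.
move=> cg gl.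
have [T [_ gT]] : \forall t \near +oo, `|g t| <= `|l| + 1.
  have /cvgrPdist_le /(_ _ ltr01) := gl; apply: filterS => t lt.
  by have := ler_normB l (l - g t); rewrite opprB addrC subrK; lra.
pose T0 := Num.max T 0.
have T00 : 0 <= T0 by rewrite le_max lexx orbT.
have cng : {within `[0, T0], continuous (fun t => `|g t|)}.
  have cgT : {within `[0, T0], continuous g}.
    apply: continuous_subspaceW cg.
    by apply: subset_itv_half_line; rewrite half_lineE.
  by move=> t; apply: cvg_norm; exact: cgT.
have [c _ gc] := EVT_max T00 cng.
exists (`|l| + 1 + `|g c|); first by rewrite !addr_ge0.
move=> s; rewrite half_lineE => s0; have [sT|Ts] := leP s T0.
  have := gc s; rewrite in_itv/= s0 sT => /(_ isT) gs.
  by rewrite (le_trans gs)// lerDr addr_ge0.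
rewrite (@le_trans _ _ (`|l| + 1)) ?lerDl//; apply: gT.
by apply: le_lt_trans Ts; rewrite le_max lexx.
Qed.

(** The domain chosen for the Volterra operator: it contains C_lim, and for the
    limit of the Picard iterates membership only takes a pointwise limit of
    measurable functions and a bound. *)
Definition bounded_measurable x :=
  (forall j, L_measurable_fun (half_line R) (fun s => x s j 0)) /\
  exists2 M, 0 <= M & forall j s, half_line R s -> `|x s j 0| <= M.

Lemma C_lim_bounded_measurable x : C_lim x -> bounded_measurable x.
Proof.
move=> /C_limP xP; split=> [j|].
  apply: borel_lebesgue_measurable_fun; first exact: measurable_itv.
  apply: subspace_continuous_measurable_fun; first exact: measurable_itv.
  exact: (xP j).1.
have /choice [M MP] : forall j, exists M, 0 <= M /\
    forall s, half_line R s -> `|x s j 0| <= M.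
  move=> j; have [cx [l xl]] := xP j.
  by have [M M0 xM] := continuous_cvg_bounded cx xl; exists M.
exists (\sum_j M j); first by rewrite sumr_ge0// => j _; exact: (MP j).1.
move=> j s Hs; rewrite (bigD1 j)//=; apply: le_trans ((MP j).2 s Hs) _.
by rewrite lerDl sumr_ge0// => k _; exact: (MP k).1.
Qed.

Lemma bounded_measurableB x y : bounded_measurable x -> bounded_measurable y ->
  bounded_measurable (fun s => x s - y s).
Proof.
move=> [mx [M M0 xM]] [my [M' M0' yM]]; split=> [j|].
  under eq_fun do rewrite !mxE; exact: measurable_funB (mx j) (my j).
exists (M + M'); first exact: addr_ge0.
move=> j s Hs; rewrite !mxE; apply: le_trans (ler_normB _ _) _.
by apply: lerD; [exact: xM|exact: yM].
Qed.

End C_lim_theory.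

(** * The Volterra operator *)

Section volterra.
Variables (R : realType) (n : nat) (A : R -> 'M[R]_n).
Local Notation mu := (lebesgue_mu R).
Implicit Types x y : R -> 'cV[R]_n.
Hypothesis iA : forall i j, L_integrable (half_line R) (fun s => A s i j).

Definition volterra x t := integral_cV `[0, t]%classic (fun s => A s *m x s).

Definition entry_sum s := \sum_i \sum_j `|A s i j|.

Lemma entry_sum_ge0 s : 0 <= entry_sum s.
Proof. by rewrite sumr_ge0// => i _; rewrite sumr_ge0. Qed.

Lemma integrable_big_sum D (h : 'I_n -> R -> R) :
  L_measurable D -> (forall i, L_integrable D (h i)) ->
  L_integrable D (fun s => \sum_i h i s).
Proof.
move=> mD hi.
have -> : EFin \o (fun s => \sum_i h i s) =
    (fun s => \sum_(i <- index_enum 'I_n) (EFin \o h i) s)%E.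
  by apply/funext => s; rewrite /= -sumEFin.
exact: (@integrable_sum _ (lebesgueTypeR R) R mu D mD).
Qed.

Lemma integrable_entry_sum : L_integrable (half_line R) entry_sum.
Proof.
have mH := @half_line_measurable R.
apply: (integrable_big_sum mH) => i; apply: (integrable_big_sum mH) => j.
exact: (integrable_norm (iA i j)).
Qed.

Lemma mulmx_entry_le (s b : R) (v : 'cV[R]_n) i :
  (forall j, `|v j 0| <= b) -> `|(A s *m v) i 0| <= entry_sum s * b.
Proof.
move=> vb; rewrite mxE; apply: le_trans (ler_norm_sum _ _ _) _.
apply: (@le_trans _ _ ((\sum_j `|A s i j|) * b)).
  by rewrite mulr_suml ler_sum// => j _; rewrite normrM ler_wpM2l.
rewrite ler_wpM2r//; first exact: le_trans (normr_ge0 _) (vb i).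
rewrite /entry_sum [leRHS](bigD1 i)//= lerDl sumr_ge0// => k _.
by rewrite sumr_ge0.
Qed.

Lemma integrable_mulmx x i : bounded_measurable x ->
  L_integrable (half_line R) (fun s => (A s *m x s) i 0).
Proof.
move=> [mx [M M0 xM]]; have mH := @half_line_measurable R.
under eq_fun do rewrite mxE.
apply: (integrable_big_sum mH) => j.
apply: (le_integrable_real mH _ _
  (integrableZr mH M (integrable_norm (iA i j)))).
  exact: measurable_funM (integrable_measurable (iA i j)) (mx j).
by move=> s Hs /=; rewrite normrM ler_wpM2l// xM.
Qed.

(** The Volterra operator is regularizing, so that solutions only have to be
    sought among bounded measurable functions. *)
Lemma volterra_C_lim x : bounded_measurable x -> C_lim (volterra x).
Proof.
move=> bx; apply/C_limP => i; have ix := integrable_mulmx i bx.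
under eq_fun do rewrite mxE.
split; first exact: primitive_continuous.
exact: primitive_cvg.
Qed.

Lemma volterraB x y t : 0 <= t ->
  bounded_measurable x -> bounded_measurable y ->
  volterra x t - volterra y t = volterra (fun s => x s - y s) t.
Proof.
move=> t0 bx bdy; apply/colP => i; rewrite !mxE -RintegralB.
- by apply: eq_Rintegral => s _; rewrite mulmxBr !mxE.
- exact: itv_lebesgue_measurable.
- exact: (L_integrable_sub_half_line true t (lexx 0) (integrable_mulmx i bx)).
- exact: (L_integrable_sub_half_line true t (lexx 0) (integrable_mulmx i bdy)).
Qed.

Lemma eq_volterra x y t : (forall s, half_line R s -> x s = y s) ->
  volterra x t = volterra y t.
Proof.
move=> xy; apply/colP => i; rewrite !mxE; apply: eq_Rintegral => s.
by rewrite inE/= in_itv/= => /andP[s0 _]; rewrite xy// half_lineE.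
Qed.

(** Existence of a weighted supremum norm, equivalent to the supremum norm, for
    which the Volterra operator has norm at most 1/2. *)
Lemma volterra_contraction : exists (w : R -> R) (W : R),
  (forall s, half_line R s -> 1 <= w s <= W) /\
  forall x (D : R), bounded_measurable x ->
    (forall j s, half_line R s -> `|x s j 0| <= D * w s) ->
    forall i t, half_line R t -> `|volterra x t i 0| <= D / 2 * w t.
Proof.
have [w [W [mw wW ww]]] :=
  exists_weight integrable_entry_sum (fun s _ => entry_sum_ge0 s).
exists w, W; split=> // x D bx xD i t Ht.
have t0 : 0 <= t by rewrite -half_lineE.
have mt : L_measurable `[0, t] by exact: itv_lebesgue_measurable.
have mH := @half_line_measurable R.
have iaw : L_integrable (half_line R) (fun s => entry_sum s * w s).
  apply: (le_integrable_real mH _ _ (integrableZr mH W integrable_entry_sum)).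
    exact: measurable_funM (integrable_measurable integrable_entry_sum) mw.
  move=> s Hs /=; have /andP[w1 w2] := wW s Hs.
  rewrite normrM (ger0_norm (entry_sum_ge0 s)) ler_wpM2l ?entry_sum_ge0//.
  by rewrite ger0_norm// (le_trans ler01).
have iaw_t := L_integrable_sub_half_line true t (lexx 0) iaw.
have iAx := L_integrable_sub_half_line true t (lexx 0) (integrable_mulmx i bx).
rewrite mxE; apply: le_trans (le_normr_Rintegral mt iAx) _.
apply: (@le_trans _ _ (\int[mu]_(s in `[0, t]) (D * (entry_sum s * w s)))).
  apply: (le_Rintegral mt (integrable_norm iAx) (integrableZl mt D iaw_t)).
  move=> s /=; rewrite in_itv/= => /andP[s0 _].
  rewrite mulrCA; apply: mulmx_entry_le => j.
  by apply: xD; rewrite half_lineE.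
rewrite (RintegralZl D mt iaw_t) -mulrA [2^-1 * _]mulrC.
apply: ler_wpM2l (ww t Ht).
have /andP[w1 _] := wW t Ht.
rewrite -(pmulr_lge0 _ (lt_le_trans ltr01 w1)).
exact: le_trans (normr_ge0 _) (xD i t Ht).
Qed.
End volterra.

(** * Picard iteration *)

Section geometric.
Variable R : realType.

Lemma cvg_div_exp2 (C : R) : C / 2 ^+ m @[m --> \oo] --> 0.
Proof.
rewrite -[X in _ --> X](mulr0 C); apply: cvgMr.
under eq_fun do rewrite -exprVn.
by apply: cvg_expr; rewrite ger0_norm ?invr_ge0// invf_lt1// ltr1n.
Qed.

Lemma le_div_exp2_eq0 (C r : R) : (forall m, `|r| <= C / 2 ^+ m) -> r = 0.
Proof.
move=> rC; apply/eqP; rewrite -normr_le0.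
rewrite -(cvg_lim (@Rhausdorff R) (cvg_div_exp2 C)).
apply: limr_ge; first by apply: cvgP; exact: cvg_div_exp2.
exact: nearW.
Qed.

(** The intervals [u m - e m, u m + e m], with e m the tail of the geometric
    series, are nested, so the supremum of the left ends lies in all of them;
    the rate of convergence comes with the limit. *)
Lemma geometric_limit (C : R) (u : nat -> R) :
  (forall m, `|u m.+1 - u m| <= C / 2 ^+ m) ->
  exists l, forall m, `|l - u m| <= 2 * C / 2 ^+ m.
Proof.
move=> uC; pose e m := 2 * C / 2 ^+ m.
have e0 m : 0 <= e m.
  by rewrite /e -mulrA mulr_ge0// (le_trans _ (uC m)).
have eS m : e m = e m.+1 + C / 2 ^+ m.
  rewrite /e exprS; field; rewrite expf_neq0//.
have up : {homo (fun m => u m - e m) : m p / (m <= p)%N >-> m <= p}.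
  apply: homo_leq => [x|y x z|m]; [exact: lexx|exact: le_trans|].
  by rewrite (eS m); have := uC m; rewrite ler_norml; lra.
have dn : {homo (fun m => u m + e m) : m p / (m <= p)%N >-> p <= m}.
  apply: homo_leq => [x|y x z /[swap]|m]; [exact: lexx|exact: le_trans|].
  by rewrite (eS m); have := uC m; rewrite ler_norml; lra.
have cross m p : u m - e m <= u p + e p.
  apply: (le_trans (up _ _ (leq_maxl m p))).
  apply: le_trans (dn _ _ (leq_maxr m p)).
  by rewrite lerD2l ge0_cp.
exists (sup [set u m - e m | m in setT]) => m.
rewrite ler_distl; apply/andP; split.
  by apply: ub_le_sup; [exists (u 0%N + e 0%N) => _ [p _ <-] | exists m].
by apply: ge_sup; [exists (u 0%N - e 0%N), 0%N | move=> _ [p _ <-]].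
Qed.
End geometric.

Section picard.
Variables (R : realType) (n : nat) (A : R -> 'M[R]_n) (zeta : R -> 'cV[R]_n).
Local Notation H := (half_line R).
Hypothesis iA : forall i j, L_integrable (half_line R) (fun s => A s i j).

(** The difference d of two solutions satisfies d = K d, hence it is bounded by
    M w / 2^m for every m. *)
Lemma volterra_eq_unique (y z : R -> 'cV[R]_n) : C_lim y -> C_lim z ->
  (forall t, H t -> zeta t = y t - volterra A y t) ->
  (forall t, H t -> zeta t = z t - volterra A z t) ->
  forall t, H t -> y t = z t.
Proof.
move=> /C_lim_bounded_measurable bdy /C_lim_bounded_measurable bz ey ez.
have [w [W [wW contr]]] := volterra_contraction iA.
pose d s := y s - z s.
have bd : bounded_measurable d by exact: bounded_measurableB.
have dK t : H t -> d t = volterra A d t.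
  move=> Ht; have t0 : 0 <= t by rewrite -half_lineE.
  have yt : y t = zeta t + volterra A y t by rewrite ey// subrK.
  have zt : z t = zeta t + volterra A z t by rewrite ez// subrK.
  rewrite -[RHS](volterraB iA t0 bdy bz) /d yt zt.
  by rewrite opprD addrACA subrr add0r.
have [_ [M M0 dM]] := bd.
have small m j s : H s -> `|d s j 0| <= M / 2 ^+ m * w s.
  elim: m j s => [|m IH] j s Hs.
    rewrite expr0 divr1; apply: le_trans (dM j s Hs) _.
    by rewrite ler_peMr//; case/andP: (wW s Hs).
  rewrite dK// exprS invfM mulrCA mulrC [_^-1 * _]mulrC.
  have := contr d (M / 2 ^+ m) bd IH j s Hs.
  by rewrite mulrC.
move=> t Ht; apply/eqP; rewrite -subr_eq0; apply/eqP/colP => i.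
rewrite [RHS]mxE; apply: (@le_div_exp2_eq0 _ (M * w t)) => m.
by rewrite mulrAC; exact: small.
Qed.

(** The pointwise limit x of the Picard iterates is a fixed point of
    step = zeta + K on the half-line only; the solution is step x. *)
Lemma volterra_eq_exists : C_lim zeta -> exists2 x, C_lim x &
  forall t, H t -> zeta t = x t - volterra A x t.
Proof.
move=> cz; have [w [W [wW contr]]] := volterra_contraction iA.
have [mz [M M0 zM]] := C_lim_bounded_measurable cz.
have w1 s : H s -> 1 <= w s by move=> /wW /andP[].
pose step x t := zeta t + volterra A x t.
have step_C x : bounded_measurable x -> C_lim (step x).
  by move=> bx; apply: C_limD => //; exact: volterra_C_lim.
pose u m := iter m step zeta.
have bu m : bounded_measurable (u m).
  apply: C_lim_bounded_measurable; elim: m => // m IH.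
  exact: step_C (C_lim_bounded_measurable IH).
have stepB x y (D : R) : bounded_measurable x -> bounded_measurable y ->
    (forall j s, H s -> `|x s j 0 - y s j 0| <= D * w s) ->
    forall j s, H s -> `|step x s j 0 - step y s j 0| <= D / 2 * w s.
  move=> bx bdy xy j s Hs; rewrite /step.
  have -> : (zeta s + volterra A x s) j 0 - (zeta s + volterra A y s) j 0 =
      volterra A (fun s => x s - y s) s j 0.
    have s0 : 0 <= s by rewrite -half_lineE.
    by rewrite -(volterraB iA s0 bx bdy) !mxE; ring.
  apply: (contr _ _ (bounded_measurableB bx bdy) _ j s Hs) => k r Hr.
  by rewrite !mxE; exact: xy.
have zMw j s : H s -> `|zeta s j 0| <= M * w s.
  by move=> Hs; apply: le_trans (zM j s Hs) _; rewrite ler_peMr// w1.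
have u_incr m j s : H s -> `|u m.+1 s j 0 - u m s j 0| <= M / 2 ^+ m.+1 * w s.
  elim: m j s => [|m IH] j s Hs.
    rewrite /u/= /step mxE addrAC subrr add0r expr1.
    by apply: contr => //; exact: C_lim_bounded_measurable.
  by rewrite exprSr invfM mulrA; exact: (stepB _ _ _ (bu _) (bu _) IH).
have /choice [x_ xP] : forall js : 'I_n * R, exists l, H js.2 ->
    forall m, `|l - u m js.2 js.1 0| <= M / 2 ^+ m * w js.2.
  move=> [j s] /=; have [Hs|nHs] := pselect (H s); last by exists 0.
  have [m|l lP] := @geometric_limit R (M / 2 * w s) (fun m => u m s j 0).
    apply: le_trans (u_incr m j s Hs) _.
    by rewrite exprS invfM mulrA mulrAC.
  exists l => _ m; apply: le_trans (lP m) _.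
  rewrite le_eqVlt; apply/orP; left; apply/eqP.
  by field; rewrite expf_neq0.
pose x s := \col_j x_ (j, s).
have xu m j s : H s -> `|x s j 0 - u m s j 0| <= M / 2 ^+ m * w s.
  by move=> Hs; rewrite mxE; exact: (xP (j, s) Hs m).
have bx : bounded_measurable x.
  split=> [j|].
    apply: (@measurable_fun_cvg _ (lebesgueTypeR R) R H (fun m s => u m s j 0)).
      by move=> m; exact: (bu m).1.
    move=> s Hs; apply/cvgrPdist_le => /= e e0.
    have := cvg_div_exp2 (M * w s) => /cvgr0Pnorm_le /(_ e e0).
    apply: filterS => m; apply: le_trans; apply: le_trans (xu m j s Hs) _.
    by rewrite mulrAC ler_norm.
  exists (M * W + M).
    have /wW /andP[+ +] : H 0 by rewrite half_lineE.
    move=> /le_trans /[apply] W1.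
    by rewrite addr_ge0 ?mulr_ge0// (le_trans ler01).
  move=> j s Hs; have /andP[w1s wWs] := wW s Hs.
  have := xu 0%N j s Hs; rewrite expr0 divr1 => xz.
  have := zM j s Hs; have : M * w s <= M * W by rewrite ler_wpM2l.
  have := ler_normD (x s j 0 - zeta s j 0) (zeta s j 0); rewrite subrK.
  by move: xz; rewrite /u/=; lra.
have fix_x s : H s -> step x s = x s.
  move=> Hs; apply/colP => j; apply/eqP; rewrite -subr_eq0; apply/eqP.
  apply: (@le_div_exp2_eq0 _ (M * w s)) => m; rewrite mulrAC.
  have h1 := stepB x (u m) _ bx (bu m) (xu m) j s Hs.
  have h2 := xu m.+1 j s Hs; rewrite distrC in h2.
  have -> : M / 2 ^+ m * w s = M / 2 ^+ m / 2 * w s + M / 2 ^+ m.+1 * w s.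
    by rewrite exprS; field; rewrite expf_neq0.
  apply: le_trans (lerD h1 h2); apply: le_trans (ler_normD _ _).
  by rewrite /u/= addrA subrK.
exists (step x); first exact: step_C.
move=> t Ht; rewrite (eq_volterra _ _ fix_x) /step addrK//.
Qed.
End picard.

Theorem lemma1p1 (R : realType) (n : nat) (N : 'cV[R]_n -> R) (hN : is_norm N)
    (A : R -> 'M[R]_n)
    (mA : lebesgue_measurable_mx A)
    (iA : (\int[@lebesgue_mu R]_(t in half_line R) (op_norm N (A t))%:E < +oo)%E)
    (zeta : R -> 'cV[R]_n) (hzeta : C_lim zeta) :
  exists x : R -> 'cV[R]_n,
    [/\ C_lim x,
        forall t, half_line R t ->
          zeta t = x t - integral_cV `[0, t]%classic (fun s => A s *m x s)
      & forall y : R -> 'cV[R]_n, C_lim y ->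
          (forall t, half_line R t ->
            zeta t = y t - integral_cV `[0, t]%classic (fun s => A s *m y s)) ->
          forall t, half_line R t -> y t = x t].
Proof.
have iA' i j := op_norm_integrable_entry hN mA iA i j.
have [x cx ex] := volterra_eq_exists iA' hzeta.
exists x; split=> // y cy ey.
exact: (volterra_eq_unique iA' cy cx ey ex).
Qed.
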